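(* There is an absolute constant $C$ such that for all $n\ge 2$ and $r\ge 2$, the Move-All-Equally algorithm is $2^{C\sqrt{\log n\cdot\log r}}$-competitive against the static optimum for $r$-uniform Online Min-Sum Set Cover on $n$ elements.
   Context: Let $U$ be a set of $n$ elements; a permutation $\pi$ of $U$ gives each element $e$ a position $\pi[e]\in\{1,\dots,n\}$, and $\pi(S)=\min_{e\in S}\pi[e]$. $d_{KT}(\pi,\sigma)$ is the number of pairs of elements ordered differently by $\pi,\sigma$. In $r$-uniform Online Min-Sum Set Cover, from an initial permutation $\pi_0$, request sets $S_1,\dots,S_m$ with $|S_t|=r$ arrive online; on arrival of $S_t$ an algorithm holding $\pi_{t-1}$ pays $\pi_{t-1}(S_t)$ and then moves to $\pi_t$ paying $d_{KT}(\pi_{t-1},\pi_t)$. The static optimum is $\mathrm{OPT}=\min_\pi\sum_t\pi(S_t)$. An algorithm is $c$-competitive if its cost is at most $c\cdot\mathrm{OPT}+\alpha$ for all initial permutations and sequences, with $\alpha$ independent of the sequence (possibly depending on $n,r$). Move-All-Equally: given current permutation $\pi$ and request $S$, let $k=\pi(S)$; the new permutation places each $e\in S$ at position $\pi[e]-(k-1)$ and the elements of $U\setminus S$ fill the remaining positions in their relative order in $\pi$. *)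

(* Defs.v *)
From HB Require Import structures.
From mathcomp Require Import all_boot all_order all_fingroup all_algebra.
From mathcomp Require Import reals exp.

Set Implicit Arguments.
Unset Strict Implicit.
Unset Printing Implicit Defensive.

Import Order.TTheory GRing.Theory Num.Theory.

(** The ground set is ['I_n]; a permutation [pi : 'S_n] maps an element [e] to
    its position.  Ordinals count from 0, so the 1-based position is [pos]. *)

Definition pos n (pi : 'S_n) (e : 'I_n) : nat := (pi e).+1.

(** Positions are at most [n], so the neutral element [n] is harmless as soon
    as [S] is nonempty. *)
Definition access n (pi : 'S_n) (S : {set 'I_n}) : nat :=
  \big[minn/n]_(e in S) pos pi e.

(** Each discordant unordered pair is counted once, ordered as in [pi]. *)
Definition dKT n (pi sigma : 'S_n) : nat :=
  #|[set p : 'I_n * 'I_n |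
      (pos pi p.1 < pos pi p.2) && (pos sigma p.2 < pos sigma p.1)]|.

Definition static_cost n (pi : 'S_n) (s : seq {set 'I_n}) : nat :=
  \sum_(S <- s) access pi S.

Definition OPT n (s : seq {set 'I_n}) : nat :=
  \big[minn/static_cost (1%g : 'S_n) s]_(pi : 'S_n) static_cost pi s.

(** An algorithm is given by the permutation to which it moves, as a function
    of the one it holds and of the current request (deterministic and
    memoryless). *)
Definition algorithm n := 'S_n -> {set 'I_n} -> 'S_n.

Fixpoint alg_cost n (A : algorithm n) (pi : 'S_n) (s : seq {set 'I_n}) : nat :=
  if s is S0 :: s' then
    access pi S0 + dKT pi (A pi S0) + alg_cost A (A pi S0) s'
  else 0.

Definition uniform n (r : nat) (s : seq {set 'I_n}) : bool :=
  all (fun S : {set 'I_n} => #|S| == r) s.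

Definition competitive (R : realType) n (r : nat) (c : R) (A : algorithm n) :
    Prop :=
  exists alpha : R, forall (pi0 : 'S_n) (s : seq {set 'I_n}), uniform r s ->
    ((alg_cost A pi0 s)%:R <= c * (OPT s)%:R + alpha)%R.

Definition log2 (R : realType) (x : R) : R := (ln x / ln 2)%R.

(** Move-All-Equally, with positions counted from 0 (the shift by
    [access pi S - 1] is the same as for 1-based positions).  An element outside
    [S] preceded in [pi] by exactly [j] elements outside [S] takes the [j]-th
    position left free by [S]. *)

Definition mae_shift n (pi : 'S_n) (S : {set 'I_n}) (e : 'I_n) : nat :=
  pi e - (access pi S - 1).

Definition mae_free n (pi : 'S_n) (S : {set 'I_n}) : seq nat :=
  [seq i <- iota 0 n | i \notin [seq mae_shift pi S e | e in S]].

Definition mae_rank n (pi : 'S_n) (S : {set 'I_n}) (e : 'I_n) : nat :=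
  #|[set f | (f \notin S) && (pi f < pi e)]|.

Definition mae_pos n (pi : 'S_n) (S : {set 'I_n}) (e : 'I_n) : nat :=
  if e \in S then mae_shift pi S e
  else nth 0 (mae_free pi S) (mae_rank pi S e).

Lemma access_le n (pi : 'S_n) (S : {set 'I_n}) e :
  e \in S -> access pi S <= pos pi e.
Proof.
move=> eS; rewrite /access; have := mem_index_enum e.
elim: (index_enum _) => //= f l IH; rewrite inE big_cons => /predU1P[<-|/IH le].
  by rewrite eS geq_minl.
by case: ifP => // _; apply: leq_trans (geq_minr _ _) le.
Qed.

Lemma mae_shift_inj n (pi : 'S_n) (S : {set 'I_n}) :
  {in S &, injective (mae_shift pi S)}.
Proof.
move=> e f eS fS; have := access_le pi eS; have := access_le pi fS.
rewrite /pos /mae_shift => lef lee /eqP.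
have le1 a b : a <= b.+1 -> a - 1 <= b by rewrite leq_subLR add1n.
rewrite -(eqn_add2r (access pi S - 1)) !subnK ?le1 // => /eqP.
by move/val_inj/perm_inj.
Qed.

Lemma mae_shift_lt n (pi : 'S_n) (S : {set 'I_n}) e : mae_shift pi S e < n.
Proof. exact: leq_ltn_trans (leq_subr _ _) (ltn_ord _). Qed.

Lemma size_mae_free n (pi : 'S_n) (S : {set 'I_n}) :
  size (mae_free pi S) = #|~: S|.
Proof.
set im := [seq mae_shift pi S e | e in S].
have uim : uniq im.
  rewrite map_inj_in_uniq ?enum_uniq // => e f.
  by rewrite !mem_enum; apply: mae_shift_inj.
have eqp : perm_eq [seq i <- iota 0 n | i \in im] im.
  apply: uniq_perm; rewrite ?filter_uniq ?iota_uniq // => i.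
  rewrite mem_filter mem_iota /= add0n andb_idr //.
  by case/imageP=> e _ ->; apply: mae_shift_lt.
have := count_predC (mem im) (iota 0 n).
rewrite size_iota -!size_filter (perm_size eqp) size_image.
move=> h; apply/eqP; rewrite -(eqn_add2l #|S|) cardsC card_ord -{2}h.
by apply/eqP.
Qed.

Lemma mae_rank_homo n (pi : 'S_n) (S : {set 'I_n}) e f :
  e \notin S -> pi e < pi f -> mae_rank pi S e < mae_rank pi S f.
Proof.
move=> eS lt; apply: proper_card; apply/properP; split.
  apply/subsetP=> g; rewrite !inE => /andP[-> /ltn_trans]; exact.
by exists e; rewrite !inE ?eS ?lt ?ltnn.
Qed.

Lemma mae_rank_lt n (pi : 'S_n) (S : {set 'I_n}) e :
  e \notin S -> mae_rank pi S e < size (mae_free pi S).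
Proof.
move=> eS; rewrite size_mae_free; apply: proper_card; apply/properP; split.
  by apply/subsetP=> g; rewrite !inE => /andP[].
by exists e; rewrite !inE ?ltnn ?andbF.
Qed.

Lemma mae_pos_free n (pi : 'S_n) (S : {set 'I_n}) e :
  e \notin S -> mae_pos pi S e \in mae_free pi S.
Proof.
by move=> eS; rewrite /mae_pos (negbTE eS) mem_nth // mae_rank_lt.
Qed.

Lemma mae_pos_lt n (pi : 'S_n) (S : {set 'I_n}) e : mae_pos pi S e < n.
Proof.
case: (boolP (e \in S)) => eS; first by rewrite /mae_pos eS mae_shift_lt.
by have := mae_pos_free pi eS; rewrite mem_filter mem_iota => /and3P[].
Qed.

Lemma mae_pos_homo n (pi : 'S_n) (S : {set 'I_n}) e f :
  e \notin S -> f \notin S -> pi e < pi f -> mae_pos pi S e < mae_pos pi S f.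
Proof.
move=> eS fS lt; rewrite /mae_pos (negbTE eS) (negbTE fS).
have srt : sorted ltn (mae_free pi S).
  exact: (sorted_filter ltn_trans _ (iota_ltn_sorted 0 n)).
by apply: (sorted_ltn_nth ltn_trans 0 srt); rewrite ?inE ?mae_rank_lt
  ?mae_rank_homo.
Qed.

Lemma mae_pos_neq n (pi : 'S_n) (S : {set 'I_n}) e f :
  e \in S -> f \notin S -> mae_pos pi S e != mae_pos pi S f.
Proof.
move=> eS /(mae_pos_free pi); rewrite mem_filter => /andP[fS _].
apply: contraNneq fS => <-; rewrite /mae_pos eS.
by apply/imageP; exists e.
Qed.

Lemma mae_ord_inj n (pi : 'S_n) (S : {set 'I_n}) :
  injective (fun e => Ordinal (mae_pos_lt pi S e)).
Proof.
move=> e f /(congr1 val) /= eqp.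
have [eS|eS] := boolP (e \in S); have [fS|fS] := boolP (f \in S).
- by move: eqp; rewrite /mae_pos eS fS; apply: mae_shift_inj.
- by have := mae_pos_neq pi eS fS; rewrite eqp eqxx.
- by have := mae_pos_neq pi fS eS; rewrite eqp eqxx.
- have [lt|lt|/val_inj/perm_inj //] := ltngtP (pi e) (pi f).
  + by have := mae_pos_homo eS fS lt; rewrite eqp ltnn.
  + by have := mae_pos_homo fS eS lt; rewrite eqp ltnn.
Qed.

Definition move_all_equally n : algorithm n :=
  fun pi S => perm (@mae_ord_inj n pi S).

Lemma move_all_equally_in n (pi : 'S_n) (S : {set 'I_n}) e :
  e \in S ->
  pos (move_all_equally pi S) e = pos pi e - (access pi S - 1).
Proof.
move=> eS; rewrite /pos permE /= /mae_pos eS /mae_shift subSn //.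
by have := access_le pi eS; rewrite /pos leq_subLR add1n.
Qed.

Lemma move_all_equally_notin n (pi : 'S_n) (S : {set 'I_n}) e f :
  e \notin S -> f \notin S -> pos pi e < pos pi f ->
  pos (move_all_equally pi S) e < pos (move_all_equally pi S) f.
Proof. by move=> eS fS; rewrite /pos !permE /= !ltnS; apply: mae_pos_homo. Qed.

(* Main.v *)
Require Import Defs.
From HB Require Import structures.
From mathcomp Require Import all_boot all_order all_fingroup all_algebra.
From mathcomp Require Import reals exp.
From mathcomp Require Import zify lra.

Set Implicit Arguments.
Unset Strict Implicit.
Unset Printing Implicit Defensive.

Import Order.TTheory GRing.Theory Num.Theory.

(** Fix an optimal static permutation [opt] and a base [B], and let the level of
    an element be the integer part of the base-[B] logarithm of its position in
    [opt].  The potential is the weighted sum of the current positions, where the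
    weight drops by a factor [2 r] from one level to the next.  On a request
    with access cost [K + 1], the element [e] that [opt] uses advances by [K],
    while the elements outside the request retreat by [r K] in total, each by
    at most [r].  Those of higher level than [e] thus cost at most half of the
    gain of [e]; the others are at most [B] times as many as the position of
    [e] in [opt], and are charged to [opt].  This gives a ratio of about
    [r^2 B (2 r)^(log n / log B)], which is balanced by
    [log B = sqrt (log n log r)]. *)

(** * Counting predecessors in a permutation *)

Lemma card_perm_lt n (pi : 'S_n) m : #|[set f | pi f < m]| = minn m n.
Proof.
have -> : [set f | pi f < m] = pi @^-1: [set i : 'I_n | i < m].
  by apply/setP=> f; rewrite !inE.
rewrite (card_preimset _ (@perm_inj _ pi)) cardE -(size_map val).
have -> : [seq val i | i <- enum [set i : 'I_n | i < m]] =
          [seq i <- iota 0 n | i < m].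
  rewrite -val_enum_ord filter_map [in RHS]enumT; congr map.
  by apply: eq_filter => i; rewrite !inE.
rewrite size_filter.
clear pi; elim: n => [|n IH]; first by rewrite minn0.
by rewrite -addn1 iotaD count_cat IH /= add0n addn0; lia.
Qed.

Lemma card_perm_before n (pi : 'S_n) e : #|[set f | pi f < pi e]| = pi e.
Proof. by rewrite card_perm_lt; apply/minn_idPl/ltnW/ltn_ord. Qed.

Lemma card_perm_before_in n (pi : 'S_n) (S : {set 'I_n}) e :
  #|[set f | (f \notin S) && (pi f < pi e)]| +
    #|[set f | (f \in S) && (pi f < pi e)]| = pi e.
Proof.
rewrite -[RHS](card_perm_before pi) addnC.
rewrite -(cardsID S [set f | pi f < pi e]); congr (_ + _); apply: eq_card => f;
  by rewrite !inE // andbC.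
Qed.

Lemma access_attained n (pi : 'S_n) (S : {set 'I_n}) :
  S != set0 -> exists2 e, e \in S & access pi S = pos pi e.
Proof.
case/set0Pn=> e0 e0S.
have [|[e eS eqe]] : access pi S = n \/ exists2 e, e \in S & access pi S = pos pi e.
- rewrite /access; elim/big_ind: _ => [|x y hx hy|e eS]; first by left.
  + by rewrite /minn; case: ifP.
  + by right; exists e.
(* If the minimum is the default [n], then [e0] sits at the last position and attains it. *)
- move=> eqn; have := access_le pi e0S; rewrite eqn => le; exists e0 => //.
  by apply/eqP; rewrite eqn_leq le /pos ltn_ord.
- by exists e.
Qed.

(** * Displacements and swaps in one move *)

Section Step.
Variables (n : nat) (pi : 'S_n) (S : {set 'I_n}).
Local Notation pi' := (move_all_equally pi S).
Local Notation K := (access pi S - 1).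

Lemma mae_in e : e \in S -> (pi' e + K = pi e)%N.
Proof.
move=> eS; have := access_le pi eS; have := move_all_equally_in pi eS.
by rewrite /pos; lia.
Qed.

Lemma mae_in_lt e f : e \in S -> f \in S -> (pi' f < pi' e) = (pi f < pi e).
Proof. by move=> /mae_in he /mae_in hf; lia. Qed.

Lemma mae_notin_lt e f :
  e \notin S -> f \notin S -> (pi' f < pi' e) = (pi f < pi e).
Proof.
move=> eS fS; apply/idP/idP; last exact: (@move_all_equally_notin _ pi S f e).
apply: contraTT; rewrite -!leqNgt leq_eqVlt => /predU1P[/val_inj/perm_inj -> //|].
by move/(@move_all_equally_notin _ pi S e f eS fS)/ltnW; rewrite /pos ltnS.
Qed.

Definition overtaken g := [set f | [&& f \notin S, pi f < pi g & pi' g < pi' f]].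

(* The elements outside [S] keep their order, so those preceding [g] form
   nested sets before and after the move. *)
Lemma mae_before_subset g : g \in S ->
  [set f | (f \notin S) && (pi' f < pi' g)] \subset
  [set f | (f \notin S) && (pi f < pi g)] /\
  #|[set f | (f \notin S) && (pi' f < pi' g)]| + K =
  #|[set f | (f \notin S) && (pi f < pi g)]|.
Proof.
move=> gS; set X' := [set f | _ & pi' f < _]; set X := [set f | _ & pi f < _].
have card_eq : #|X'| + K = #|X|.
  have := mae_in gS; rewrite -(card_perm_before_in pi S g).
  rewrite -(card_perm_before_in pi' S g) -/X -/X'.
  rewrite (_ : [set f | (f \in S) && (pi' f < pi' g)] =
               [set f | (f \in S) && (pi f < pi g)]); first by lia.
  by apply/setP=> f; rewrite !inE; case fS: (f \in S); rewrite //= mae_in_lt.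
split=> //; apply/subsetP=> f fX'; have := fX'; rewrite !inE => /andP[fS ltf].
rewrite fS /= ltnNge; apply/negP=> le.
have neq : g != f by apply: contraNneq fS => <-.
have ltgf : pi g < pi f.
  by rewrite ltn_neqAle le andbT; apply: contraNneq neq => /val_inj/perm_inj ->.
(* If [f] passed from behind [g] to ahead of it, all of [X] would still precede [f], hence [g],
   making [X'] strictly larger. *)
suff : #|X| < #|X'| by rewrite -card_eq; lia.
apply/proper_card/properP; split; last first.
  by exists f => //; rewrite inE fS /= -leqNgt.
apply/subsetP=> h; rewrite !inE => /andP[hS lth]; rewrite hS /=.
apply: ltn_trans ltf; rewrite mae_notin_lt //; exact: ltn_trans ltgf.
Qed.

Lemma card_overtaken g : g \in S -> #|overtaken g| = K.
Proof.
move=> gS; have [sub /eqP] := mae_before_subset gS.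
rewrite -(cardsID [set f | (f \notin S) && (pi' f < pi' g)]
  [set f | (f \notin S) && (pi f < pi g)]) (setIidPr sub) eqn_add2l => /eqP ->.
apply: eq_card => f; rewrite !inE.
case: (boolP (f \in S)) => //= fS; rewrite andbC -leqNgt [in RHS]leq_eqVlt.
by case: eqP => [/val_inj/perm_inj gf|_] //; rewrite -gf gS in fS.
Qed.

(** A predecessor of [f] after the move either preceded it before or is a member of [S] that
    overtook it. *)
Lemma mae_notin_le f :
  f \notin S -> pi' f <= pi f + #|[set g in S | f \in overtaken g]|.
Proof.
move=> fS; rewrite -(card_perm_before pi') -(card_perm_before pi).
apply: leq_trans (leq_card_setU _ _); apply/subset_leq_card/subsetP=> g.
rewrite !inE => lt; have [gS|gS] := boolP (g \in S); last first.
  by move: lt; rewrite mae_notin_lt // => ->.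
rewrite fS lt /= andbT; case: ltngtP => // /val_inj/perm_inj gf.
by rewrite -gf gS in fS.
Qed.

Lemma sum_overtaken :
  \sum_(f | f \notin S) #|[set g in S | f \in overtaken g]| = #|S| * K.
Proof.
rewrite -sum_nat_const -(eq_bigr _ card_overtaken).
under eq_bigr => f _ do rewrite -sum1_card.
under [RHS]eq_bigr => g _ do rewrite -sum1_card.
rewrite [RHS](exchange_big_dep (fun f => f \notin S)) /=; last first.
  by move=> g f _; rewrite inE => /andP[].
by apply: eq_bigr => f fS; apply: eq_bigl => g; rewrite inE.
Qed.

(** Order is kept within [S] and within its complement, and no outsider passes a member of [S]; so
    every swap is an overtaking by some [g] in [S], and each [g] makes [K] of them. *)
Lemma dKT_mae : dKT pi pi' <= #|S| * K.
Proof.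
rewrite -sum_nat_const -(eq_bigr _ card_overtaken).
under [leqRHS]eq_bigr => g _ do rewrite -sum1_card.
rewrite (exchange_big_dep predT) //= pair_big_dep /= sum1_card.
apply/subset_leq_card/subsetP=> -[f g]; rewrite !inE /pos /= !ltnS => /andP[lt gt].
have [gS|gS] := boolP (g \in S); have [fS|fS] := boolP (f \in S).
- by move: gt; rewrite mae_in_lt // ltnNge ltnW.
- by rewrite unfold_in /= !inE gS fS lt gt.
- have [/subsetP/(_ g)] := mae_before_subset fS.
  by rewrite !inE gS gt /= ltnNge ltnW // => /(_ isT).
- by move: gt; rewrite mae_notin_lt // ltnNge ltnW.
Qed.
End Step.

(** * Weighted potential and amortized cost *)

Section Potential.
Variables (n r B : nat) (opt : 'S_n).
Hypotheses (r_gt0 : 0 < r) (B_gt1 : 1 < B).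

Definition level e := trunc_log B (pos opt e).

(** Counting levels down from the top one keeps the weights positive integers. *)
Definition weight e := (2 * r) ^ (trunc_log B n - level e).

Definition potential (pi : 'S_n) := \sum_e weight e * pi e.

Lemma level_le e : level e <= trunc_log B n.
Proof. exact/leq_trunc_log/ltn_ord. Qed.

Lemma weight_gt0 e : 0 < weight e.
Proof. by rewrite expn_gt0 muln_gt0 r_gt0. Qed.

Lemma weight_le e : weight e <= (2 * r) ^ trunc_log B n.
Proof. by rewrite leq_pexp2l ?leq_subr // muln_gt0 r_gt0. Qed.

Lemma weight_drop e f : level e < level f -> 2 * r * weight f <= weight e.
Proof.
move=> lt; rewrite -expnS leq_pexp2l ?muln_gt0 ?r_gt0 //.
by have := level_le f; lia.
Qed.

Lemma card_level_le e : #|[set f | level f <= level e]| <= B * pos opt e.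
Proof.
apply: (@leq_trans (B ^ (level e).+1)); last first.
  by rewrite expnS leq_mul2l trunc_logP ?orbT.
apply: leq_trans (_ : #|[set f | opt f < B ^ (level e).+1]| <= _); last first.
  by rewrite card_perm_lt geq_minl.
apply/subset_leq_card/subsetP=> f; rewrite !inE => le.
apply: ltn_trans (ltnSn _) _; apply: leq_trans (trunc_log_ltn _ B_gt1) _.
by rewrite leq_exp2l.
Qed.

(** The bound depends on neither [pi] nor [opt], so it yields the additive constant. *)
Lemma potential_le pi : potential pi <= n * ((2 * r) ^ trunc_log B n * n).
Proof.
rewrite -[X in X * _ ]card_ord -sum_nat_const; apply: leq_sum => e _.
by rewrite leq_mul ?weight_le // ltnW.
Qed.

Section Request.
Variables (pi : 'S_n) (S : {set 'I_n}) (e : 'I_n).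
Hypotheses (card_S : #|S| = r) (eS : e \in S).
Local Notation pi' := (move_all_equally pi S).
Local Notation K := (access pi S - 1).
Local Notation overtakes f := #|[set g in S | f \in overtaken pi S g]|.

Lemma potential_in :
  \sum_(g in S) weight g * pi' g + weight e * K <= \sum_(g in S) weight g * pi g.
Proof.
rewrite !(bigD1 e eS) /= addnAC -mulnDr mae_in // leq_add2l.
apply: leq_sum => g /andP[gS _]; rewrite leq_mul2l -(mae_in pi gS).
by rewrite leq_addr orbT.
Qed.

Lemma potential_out :
  \sum_(f | f \notin S) weight f * pi' f <=
  \sum_(f | f \notin S) weight f * pi f +
    \sum_(f | f \notin S) weight f * overtakes f.
Proof.
rewrite -big_split; apply: leq_sum => f fS /=.
by rewrite -mulnDr leq_mul2l mae_notin_le ?orbT.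
Qed.

Lemma overtakes_le f : overtakes f <= r.
Proof.
by rewrite -card_S subset_leq_card //; apply/subsetP=> g; rewrite inE => /andP[].
Qed.

(* The few elements of level at most that of [e] are each overtaken at most
   [r] times; the others are overtaken [r * K] times in total, but weigh at
   most [weight e / (2 * r)]. *)
Lemma weight_overtakes :
  2 * (\sum_(f | f \notin S) weight f * overtakes f) <=
  2 * ((2 * r) ^ trunc_log B n * r * B * pos opt e) + weight e * K.
Proof.
rewrite (bigID (fun f => level f <= level e)) /= mulnDr; apply: leq_add.
  rewrite leq_mul2l /=.
  apply: leq_trans (_ : \sum_(f in [set f | level f <= level e])
                         (2 * r) ^ trunc_log B n * r <= _); last first.
    by rewrite sum_nat_const mulnC -[leqRHS]mulnA leq_mul2l card_level_le orbT.
  rewrite big_mkcond [leqRHS]big_mkcond; apply: leq_sum => f _ /=.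
  rewrite inE; case: (f \notin S) => //=; case: ifP => // _.
  by rewrite leq_mul ?weight_le ?overtakes_le.
rewrite -(leq_pmul2l r_gt0) mulnA [r * 2]mulnC.
apply: (@leq_trans (\sum_(f | f \notin S) weight e * overtakes f)); last first.
  by rewrite -big_distrr /= sum_overtaken card_S mulnCA.
rewrite big_distrr /= big_mkcondr; apply: leq_sum => f _.
rewrite -ltnNge; case: ifP => // /weight_drop le.
by rewrite mulnA leq_mul2r le orbT.
Qed.

(** In the doubled potential, [e] gains [2 * weight e * K] and higher levels lose at most
    [weight e * K], which leaves at least [K]. *)
Lemma potential_step :
  K + 2 * potential pi' <=
  2 * potential pi + 2 * ((2 * r) ^ trunc_log B n * r * B * pos opt e).
Proof.
rewrite /potential (bigID (mem S)) [in leqRHS](bigID (mem S)) /=.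
have leK : K <= weight e * K by rewrite leq_pmull ?weight_gt0.
have arith a a' b b' d m w k : a' + w <= a -> b' <= b + d ->
    2 * d <= 2 * m + w -> k <= w -> k + 2 * (a' + b') <= 2 * (a + b) + 2 * m.
  by lia.
exact: arith potential_in potential_out weight_overtakes leK.
Qed.
End Request.

(** A request costs at most [1 + r.+1 * K]: the [1] is charged to the access cost of [opt], the rest
    to [r.+1] copies of [potential_step]. *)
Definition ratio := 1 + 2 * (r.+1 * ((2 * r) ^ trunc_log B n * r * B)).

Lemma mae_cost_step pi (S : {set 'I_n}) : #|S| = r ->
  access pi S + dKT pi (move_all_equally pi S) +
    2 * r.+1 * potential (move_all_equally pi S) <=
  2 * r.+1 * potential pi + ratio * access opt S.
Proof.
move=> card_S; have [|e eS ->] := @access_attained n opt S.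
  by rewrite -card_gt0 card_S.
have := dKT_mae pi S; rewrite card_S.
have := leq_mul (leqnn r.+1) (potential_step pi card_S eS).
have : 0 < pos opt e by [].
rewrite /ratio; set P := (2 * r) ^ _ * _ * _; move: (pos opt e) (potential _).
move: (potential _) (dKT _ _) => ? ? ? ?; nia.
Qed.

Lemma mae_cost pi s : uniform r s ->
  alg_cost (@move_all_equally n) pi s <=
  2 * r.+1 * potential pi + ratio * static_cost opt s.
Proof.
elim: s pi => [|S s IH] pi //= /andP[/eqP card_S /(IH (move_all_equally pi S))].
have := mae_cost_step pi card_S; rewrite /static_cost big_cons mulnDr; lia.
Qed.
End Potential.

Lemma OPT_attained n (s : seq {set 'I_n}) :
  exists opt : 'S_n, OPT s = static_cost opt s.
Proof.
rewrite /OPT; elim/big_ind: _ => [|x y hx hy|opt _]; first by exists 1%g.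
  by rewrite /minn; case: ifP.
by exists opt.
Qed.

(** * Choice of the base and the final exponent *)

Section Logarithm.
Variable R : realType.
Local Open Scope ring_scope.
Local Notation lg m := (log2 (m%:R : R)).

Lemma ln2_gt0 : 0 < ln 2 :> R.
Proof. by rewrite ln_gt0 // ltr1n. Qed.

Lemma log2_nat_le m k : (0 < m)%N -> (m <= k)%N -> lg m <= lg k.
Proof.
move=> m_gt0 le_mk; rewrite /log2 ler_pM2r ?invr_gt0 ?ln2_gt0 //.
by rewrite ler_ln ?posrE ?ltr0n ?ler_nat // (leq_trans m_gt0).
Qed.

Lemma log2_nat_exp2 m : lg (2 ^ m) = m%:R.
Proof.
by rewrite /log2 natrX lnXn // -[_ *+ m]mulr_natl mulfK // gt_eqF ?ln2_gt0.
Qed.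

Lemma log2_natK m : (0 < m)%N -> 2 `^ lg m = m%:R :> R.
Proof.
move=> m_gt0; rewrite /powR pnatr_eq0 /= /log2 divfK ?gt_eqF ?ln2_gt0 //.
by rewrite lnK // posrE ltr0n.
Qed.

Lemma ratio_le n r : (2 <= r <= n)%N -> exists2 B, (1 < B)%N &
  (ratio n r B)%:R <= 2 `^ (9 * Num.sqrt (lg n * lg r)) :> R.
Proof.
case/andP=> r_ge2 le_rn; have r_gt0 : (0 < r)%N by apply: leq_trans r_ge2.
have n_gt0 : (0 < n)%N by apply: leq_trans le_rn.
have lgr_ge1 : 1 <= lg r by have := @log2_nat_le 2 r isT r_ge2; rewrite (log2_nat_exp2 1).
have lg_rn : lg r <= lg n by apply: log2_nat_le.
set x : R := Num.sqrt _.
have x_ge0 : 0 <= x by apply: sqrtr_ge0.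
have x2 : x ^+ 2 = lg n * lg r by rewrite sqr_sqrtr; nra.
have lgr_ge0 : 0 <= lg r by lra.
have le_lgr_x : lg r <= x.
  by rewrite -(@ler_pXn2r _ 2) ?nnegrE // x2 expr2 ler_wpM2r.
have /andP[trunc_le lt_trunc] := truncn_itv x_ge0.
set b := (Num.trunc x).+1 in lt_trunc.
have b_le : b%:R <= 2 * x.
  rewrite /b -[X in X <= _]natr1; lra.
(* Here [x < b <= 2 * x], the upper bound because [x >= lg r >= 1]. *)
exists (2 ^ b)%N; first by rewrite (ltn_exp2l 0).
(* With [L] the top level, [x * L <= b * L <= lg n]; multiply by [lg r] and divide by [x]. *)
have L_le : (trunc_log (2 ^ b) n)%:R * lg r <= x.
  have : lg (2 ^ (b * trunc_log (2 ^ b) n)) <= lg n.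
    by rewrite log2_nat_le ?expn_gt0 // expnM trunc_logP // (ltn_exp2l 0).
  rewrite log2_nat_exp2 natrM; set L : R := (trunc_log _ _)%:R => le_n.
  have L_ge0 : 0 <= L by [].
  rewrite -(@ler_pM2r _ x) -?[x * x]expr2 ?x2; last by lra.
  rewrite mulrAC ler_wpM2r //; apply: le_trans le_n.
  by rewrite mulrC ler_wpM2r // ltW.
set L := trunc_log _ _ in L_le.
have nat_le : (ratio n r (2 ^ b) <= 2 ^ 3 * r * r * (2 * r) ^ L * 2 ^ b)%N.
  rewrite /ratio -/L.
  have := expn_gt0 (2 * r) L; have := expn_gt0 2 b; rewrite muln_gt0 r_gt0 /=.
  move: (_ ^ L)%N (2 ^ b)%N => Y B B_gt0 Y_gt0.
  have : (0 < Y * B)%N by rewrite muln_gt0 Y_gt0.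
  nia.
rewrite -(ler_nat R) in nat_le; apply: le_trans nat_le _.
have -> : (2 ^ 3 * r * r * (2 * r) ^ L * 2 ^ b)%:R =
    2 `^ (3 + lg r + lg r + (1 + lg r) * L%:R + b%:R) :> R.
  rewrite !powRD ?pnatr_eq0 ?implybT // powRrM powRD ?pnatr_eq0 ?implybT //.
  rewrite !log2_natK // !powR_mulrn ?powRr1 ?mulr_ge0 //.
  by rewrite ?(natrM, natrX).
(* The terms [3], [2 * lg r], [(1 + lg r) * L] and [b] are at most [3 * x], [2 * x], [2 * x] and
   [2 * x], whence the [9]. *)
apply: ler_powR; first by rewrite ler1n.
have : 0 <= L%:R :> R by [].
nra.
Qed.
End Logarithm.

Theorem theorem7 (R : realType) :
  exists C : R, forall n r : nat, 2 <= n -> 2 <= r ->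
    competitive r
      (2 `^ (C * Num.sqrt (log2 n%:R * log2 r%:R)))%R
      (@move_all_equally n).
Proof.
exists 9%R => n r _ r_ge2; have r_gt0 : 0 < r by apply: leq_trans r_ge2.
have [le_rn | lt_nr] := leqP r n; last first.
  (* For [n < r] no set has [r] elements, so only the empty sequence is uniform. *)
  exists 0%R => pi [|S s] /=; first by rewrite addr0 mulr_ge0 ?powR_ge0.
  case/andP=> /eqP card_S _.
  by have := max_card (mem S); rewrite card_S card_ord leqNgt lt_nr.
have [|B B_gt1 le_ratio] := @ratio_le R n r; first by rewrite r_ge2.
exists (2 * r.+1 * (n * ((2 * r) ^ trunc_log B n * n)))%:R%R => pi s unif.
have [opt ->] := OPT_attained s.
apply: (@le_trans _ _ (ratio n r B * static_cost opt s +
  2 * r.+1 * (n * ((2 * r) ^ trunc_log B n * n)))%:R%R).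
  rewrite ler_nat addnC; apply: leq_trans (mae_cost opt r_gt0 B_gt1 pi unif) _.
  by rewrite leq_add2r leq_mul2l potential_le ?orbT.
by rewrite natrD natrM lerD2r ler_wpM2r.
Qed.
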